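(* Let $d\ge 1$ and let $P\subset\mathbb{R}^d$ be a convex polytope with vertices in $\mathbb{Z}^d$. Suppose that $P$ multi-tiles $\mathbb{R}^d$ under the group $\mathcal{G}$, i.e. there is an integer $m$ such that $\sum_{g\in\mathcal{G}}1_P(gx)=m$ for almost every $x\in\mathbb{R}^d$. Then for every positive integer $n$, \[G_P(n)=\operatorname{vol}(P)\,G(n)^d .\]
   Context: $\mathcal{W}$ denotes the finite group of linear maps of $\mathbb{R}^d$ generated by the reflections in the coordinate hyperplanes and all permutations of the coordinates (so $|\mathcal{W}|=2^d d!$), and $\mathcal{G}$ is the group of maps of $\mathbb{R}^d$ generated by $\mathcal{W}$ and all translations by vectors of $\mathbb{Z}^d$. $1_P$ is the indicator function of $P$. For $x\in\mathbb{R}^d$, the solid angle $\omega_P(x)$ is $\operatorname{vol}(B(x,r)\cap P)/\operatorname{vol}(B(x,r))$ for all sufficiently small $r>0$ (so it is $1$ in the interior of $P$, $0$ outside $P$). Write $e(t)=e^{2\pi i t}$. The polyhedral Gauss sum is $G_P(n)=\sum_{x\in\mathbb{Z}^d}\omega_{nP}(x)\,e(\|x\|^2/n)$, where $nP$ is the dilate of $P$ by $n$, and $G(n)=\sum_{k\in\mathbb{Z}/n\mathbb{Z}}e(k^2/n)$ is the classical Gauss sum. *)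

(* Defs.v *)
From HB Require Import structures.
From mathcomp Require Import all_boot all_order all_algebra all_fingroup.
From mathcomp Require Import all_classical all_reals all_analysis.
From mathcomp Require Import complex.

Set Implicit Arguments.
Unset Strict Implicit.
Unset Printing Implicit Defensive.

Import Order.TTheory GRing.Theory Num.Theory.
Local Open Scope ring_scope.
Local Open Scope classical_set_scope.

Section Defs.
Variables (R : realType) (d : nat).

Definition vec := 'rV[R]_d.

Definition zvec (t : 'rV[int]_d) : vec := map_mx (fun z : int => z%:~R) t.

Definition sqnorm (x : vec) : R := \sum_(i < d) (x 0 i) ^+ 2.

Definition eball (x : vec) (r : R) : set vec := [set y | sqnorm (y - x) < r ^+ 2].

Definition box (a b : vec) : set vec := [set y | forall i, a 0 i <= y 0 i <= b 0 i].
Definition boxvol (a b : vec) : R := \prod_(i < d) Num.max (b 0 i - a 0 i) 0.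

Definition lebesgue_outer (A : set vec) : \bar R :=
  ereal_inf [set s | exists a b : nat -> vec,
     A `<=` \bigcup_k box (a k) (b k) /\
     s = (\sum_(0 <= k <oo) (boxvol (a k) (b k))%:E)%E].

(* Real-valued volume (used for bounded sets). *)
Definition vol (A : set vec) : R := fine (lebesgue_outer A).

Definition ae (Q : vec -> Prop) : Prop :=
  exists N : set vec, lebesgue_outer N = 0%E /\ forall x, ~ N x -> Q x.

Definition lattice_hull (V : seq 'rV[int]_d) : set vec :=
  [set x | exists lam : 'I_(size V) -> R,
     (forall i, 0 <= lam i) /\ \sum_(i < size V) lam i = 1 /\
     x = \sum_(i < size V) lam i *: zvec (tnth (in_tuple V) i)].

Definition dilate (n : R) (P : set vec) : set vec := [set n *: y | y in P].

Definition solid_angle (P : set vec) (x : vec) : R :=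
  xget 0 [set w : R | exists r0 : R, 0 < r0 /\ forall r : R, 0 < r -> r < r0 ->
     vol (eball x r `&` P) / vol (eball x r) = w].

(* The group W of signed permutations: w = (s, sigma) acts by
   (w x)_i = (-1)^(s i) * x_(sigma i).  G = { x |-> w x + t : w in W, t in Z^d }. *)
Definition Wact (s : {ffun 'I_d -> bool}) (sigma : {perm 'I_d}) (x : vec) : vec :=
  \row_i ((-1) ^+ s i * x 0 (sigma i)).

Definition Gelt := ({ffun 'I_d -> bool} * {perm 'I_d} * 'rV[int]_d)%type.

Definition Gact (g : Gelt) (x : vec) : vec := Wact g.1.1 g.1.2 x + zvec g.2.

Definition multitiles (P : set vec) : Prop :=
  exists m : int, ae (fun x =>
    (\esum_(g in [set: Gelt]) ((\1_P (Gact g x) : R)%:E) : \bar R)%E = (m%:~R)%:E).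

End Defs.

Section Gauss.
Variable R : realType.
Local Open Scope complex_scope.

Definition expi (t : R) : R[i] := (cos (2 * pi * t)) +i* (sin (2 * pi * t)).

Definition gauss (n : nat) : R[i] := \sum_(k < n) expi ((k ^ 2)%:R / n%:R).

(* Sum over Z^d of a finitely supported f : the eventual value of the
   partial sums over the cubes [-N, N]^d. *)
Definition cube_sum (d : nat) (f : 'rV[int]_d -> R[i]) (N : nat) : R[i] :=
  \sum_(u : {ffun 'I_d -> 'I_(N.*2.+1)}) f (\row_i ((u i)%:Z - N%:Z)).

Definition lattice_sum (d : nat) (f : 'rV[int]_d -> R[i]) : R[i] :=
  xget 0 [set S | exists N0 : nat, forall N, (N0 <= N)%N -> cube_sum f N = S].

Definition poly_gauss (d : nat) (P : set 'rV[R]_d) (n : nat) : R[i] :=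
  lattice_sum (fun x : 'rV[int]_d =>
    (solid_angle (dilate n%:R P) (zvec R x))%:C * expi (sqnorm (zvec R x) / n%:R)).

End Gauss.

(* Main.v *)
(** A point [x] of [Z^d] weighs [e(|x|^2/n)] in [G_P(n)], and this weight is
    invariant under the signed permutations [w] and the translations by [n Z^d].
    Averaging the tiling identity over small balls turns it into an identity for
    solid angles, valid at every point [y]: the sum over [w] and [t] of
    [omega_P (w y + t)] is [m].  Writing each lattice point, for every fixed [w],
    uniquely as [w k + n t] with [k] reduced modulo [n] gives
    [|W| G_P(n) = m G(n)^d], and integrating the tiling identity over the unit
    cube gives [m = |W| vol(P)]. *)

Require Import Defs.
From HB Require Import structures.
From mathcomp Require Import all_boot all_order all_algebra all_fingroup.
From mathcomp Require Import all_classical all_reals all_analysis.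
From mathcomp Require Import complex.
From mathcomp Require Import measurable_realfun ring lra zify.
Import Order.TTheory GRing.Theory Num.Theory.
Import numFieldNormedType.Exports.
Local Open Scope ring_scope.
Local Open Scope classical_set_scope.

(** * Lebesgue outer measure *)

(** For a single [w] the translates of [P] need not have constant multiplicity; only the sum over
    all of W is controlled. This is why [G_P(n)] is expanded once along each [w] and the sums are
    exchanged before the tiling is used: since (w k + n t) / n = w (k / n) + t, the inner sum is
    then the solid-angle identity at y = k / n. Two obstacles shape the rest. [vol] is a bare
    infimum over box covers, so additivity must come from Caratheodory measurability, and the
    normalisation from the volume of the unit cube. [solid_angle] is a choice operator, meaningful
    only if the ratio of volumes stabilises for small radii; local conicity of the polytope gives
    this, and it also turns the almost-everywhere identity into one at every point. *)

Lemma boxvol_ge0 {R : realType} {d} (a b : vec R d) : 0 <= boxvol a b.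
Proof. by apply: prodr_ge0 => i _; rewrite le_max lexx orbT. Qed.

Lemma box_boxvol_gt0 {R : realType} {d} (a b : vec R d) :
  0 < boxvol a b -> forall i, a 0 i < b 0 i.
Proof.
move=> ab0 i; rewrite ltNge; apply/negP => ba.
move: ab0; rewrite /boxvol (bigD1 i)//= (_ : Num.max _ _ = 0) ?mul0r ?ltxx//.
by apply/max_idPr; rewrite subr_le0.
Qed.

(** An empty box does not determine its corners; this monotonicity makes the volume depend on the
    set alone. When the smaller volume is positive, both corners lie in the box and can be compared
    with [a'] and [b']. *)
Lemma le_boxvol {R : realType} {d} (a b a' b' : vec R d) :
  box a b `<=` box a' b' -> boxvol a b <= boxvol a' b'.
Proof.
move=> sub; have [/box_boxvol_gt0 lt_ab|] := ltP 0 (boxvol a b); last first.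
  by move=> /le_trans; apply; exact: boxvol_ge0.
have /sub a_in : box a b a by move=> i; rewrite lexx ltW.
have /sub b_in : box a b b by move=> i; rewrite lexx ltW.
apply: ler_prod => i _; rewrite le_max lexx orbT/=.
have /andP[? _] := a_in i; have /andP[_ ?] := b_in i.
by rewrite ge_max !le_max lexx orbT andbT lerB.
Qed.

Lemma lebesgue_outer_ge0 {R : realType} {d} (A : set (vec R d)) :
  (0 <= lebesgue_outer A)%E.
Proof.
apply: le_ereal_inf_tmp => _ [a [b [_ ->]]].
by apply: nneseries_ge0 => k _ _; rewrite lee_fin boxvol_ge0.
Qed.

(* Mathcomp's [mu_ext] turns any set function on a semiring of sets into an
   outer measure; over the semiring of all sets, the box volume extended by
   [+oo] yields [lebesgue_outer]. *)
Definition all_sets (R : realType) (d : nat) := vec R d.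

Section all_sets.
Variables (R : realType) (d : nat).
HB.instance Definition _ := Pointed.copy (all_sets R d) 'rV[R]_d.
HB.instance Definition _ := @isMeasurable.Build default_measure_display
  (all_sets R d) setT I (fun _ _ => I) (fun _ _ => I).
End all_sets.

Definition box_premeasure {R : realType} {d} (A : set (all_sets R d)) : \bar R :=
  if pselect (exists ab : vec R d * vec R d, A = box ab.1 ab.2) is left h then
    (boxvol (projT1 (cid h)).1 (projT1 (cid h)).2)%:E else +oo%E.

Lemma box_premeasure_box {R : realType} {d} (a b : vec R d) :
  box_premeasure (box a b) = (boxvol a b)%:E.
Proof.
rewrite /box_premeasure; case: pselect => [h|[]]; last by exists (a, b).
case: cid => -[a' b']/= e; congr EFin; apply/le_anti/andP.
by split; apply: le_boxvol; rewrite e.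
Qed.

Lemma box_premeasure_ge0 {R : realType} {d} (A : set (all_sets R d)) :
  (0 <= box_premeasure A)%E.
Proof.
by rewrite /box_premeasure; case: pselect => h; rewrite ?leey// lee_fin boxvol_ge0.
Qed.

(** In dimension 0 the only box is the one-point space, of volume 1, and the outer measure of the
    empty set would not vanish; hence [d.+1] here and below. *)
Lemma set0_box {R : realType} {d} : set0 = box (const_mx 1) (0 : vec R d.+1).
Proof.
apply/seteqP; split=> // x /(_ ord0); rewrite !mxE => /andP[x1 x0].
by have := le_trans x1 x0; rewrite ler10.
Qed.

Lemma box_premeasure0 {R : realType} {d} :
  box_premeasure (set0 : set (all_sets R d.+1)) = 0%E.
Proof.
rewrite set0_box box_premeasure_box /boxvol big_ord_recl.
by rewrite (_ : Num.max _ _ = 0) ?mul0r//; apply/max_idPr; rewrite !mxE lerBlDr add0r ler01.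
Qed.

Lemma mu_ext_box_premeasure {R : realType} {d} :
  mu_ext (@box_premeasure R d) = @lebesgue_outer R d.
Proof.
apply/funext => A; apply/le_anti/andP; split; apply: le_ereal_inf_tmp.
  move=> _ [a [b [Aab ->]]]; apply: ereal_inf_lbound.
  exists (fun k => box (a k) (b k)); first by split.
  by apply: eq_eseriesr => k _; exact: box_premeasure_box.
move=> _ [B [_ AB] <-].
(* A cover with a member of premeasure [+oo] has infinite total and cannot lower the infimum; in any
   other cover every member is a box. *)
have [[k Bk]|Bfin] := pselect (exists k, box_premeasure (B k) = +oo%E).
  rewrite (@eseries_pinfty _ _ xpredT k) ?leey// => n _.
  by rewrite -ltNye (lt_le_trans _ (box_premeasure_ge0 _)).
have /choice[ab Bab] : forall k, exists ab : vec R d * vec R d, B k = box ab.1 ab.2.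
  move=> k; apply: contrapT => nB; apply: Bfin; exists k.
  by rewrite /box_premeasure; case: pselect.
apply: ereal_inf_lbound; exists (fun k => (ab k).1), (fun k => (ab k).2); split.
  by move=> x /AB[k _ Bx]; exists k => //; rewrite -Bab.
by apply: eq_eseriesr => k _; rewrite Bab box_premeasure_box.
Qed.

Lemma lebesgue_outer0 {R : realType} {d} : lebesgue_outer (set0 : set (vec R d.+1)) = 0%E.
Proof.
rewrite -mu_ext_box_premeasure; apply: mu_ext0.
  exact: box_premeasure0.
exact: box_premeasure_ge0.
Qed.

Lemma lebesgue_outer_mono {R : realType} {d} :
  {homo @lebesgue_outer R d : A B / A `<=` B >-> (A <= B)%E}.
Proof.
move=> A B; rewrite -mu_ext_box_premeasure; exact: (@le_mu_ext _ (all_sets R d)).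
Qed.

Lemma lebesgue_outer_sigma_subadditive {R : realType} {d} :
  sigma_subadditive (@lebesgue_outer R d).
Proof.
rewrite -mu_ext_box_premeasure.
by apply: (@mu_ext_sigma_subadditive _ (all_sets R d)); exact: box_premeasure_ge0.
Qed.

Section lebesgue_outer_measure.
Variables (R : realType) (d : nat).
HB.instance Definition _ := isOuterMeasure.Build R (vec R d.+1)
  (@lebesgue_outer R d.+1) lebesgue_outer0 lebesgue_outer_ge0
  lebesgue_outer_mono lebesgue_outer_sigma_subadditive.
End lebesgue_outer_measure.

Local Notation lmeas R d :=
  (@lebesgue_outer R d.+1 : {outer_measure set (vec R d.+1) -> \bar R}).

Lemma lebesgue_outer_box {R : realType} {d} (a b : vec R d.+1) :
  (lebesgue_outer (box a b) <= (boxvol a b)%:E)%E.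
Proof.
apply: ereal_inf_lbound.
exists (fun k => if k is 0%N then a else const_mx 1).
exists (fun k => if k is 0%N then b else 0); split; first by move=> x abx; exists 0%N.
rewrite nneseries_recl//; last by move=> k _; rewrite lee_fin boxvol_ge0.
rewrite eseries_cond eseries0 ?adde0// => -[//|k] _ _.
by rewrite -box_premeasure_box -set0_box box_premeasure0.
Qed.

(** The hyperplane cuts each box of a cover into two boxes, with truncated corners [lo] and [hi],
    whose volumes add up. Points on the hyperplane may or may not belong to [H], so open and closed
    half-spaces are treated at once. *)
Lemma caratheodory_halfspace {R : realType} {d} (i : 'I_d.+1) (c : R) (H : set (vec R d.+1)) :
  (forall x : vec R d.+1, x 0 i < c -> H x) ->
  (forall x : vec R d.+1, H x -> x 0 i <= c) ->
  (lmeas R d).-caratheodory H.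
Proof.
move=> ltH Hle; apply: le_caratheodory_measurable => X.
apply: le_ereal_inf_tmp => _ [a [b [Xab ->]]].
pose lo k : vec R d.+1 := \row_j if j == i then Num.min (b k 0 i) c else b k 0 j.
pose hi k : vec R d.+1 := \row_j if j == i then Num.max (a k 0 i) c else a k 0 j.
have vE k : boxvol (a k) (b k) = boxvol (a k) (lo k) + boxvol (hi k) (b k).
  have bD1 (u v : vec R d.+1) : boxvol u v = Num.max (v 0 i - u 0 i) 0 *
      \prod_(j < d.+1 | j != i) Num.max (v 0 j - u 0 j) 0.
    by rewrite /boxvol (bigD1 i).
  rewrite (bD1 (a k) (b k)) (bD1 (a k) (lo k)) (bD1 (hi k) (b k)).
  set p := \prod_(j < d.+1 | j != i) Num.max (b k 0 j - a k 0 j) 0.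
  rewrite [X in _ * X + _](_ : _ = p); last first.
    by apply: eq_bigr => j /negPf ji; rewrite !mxE ji.
  rewrite [X in _ + _ * X](_ : _ = p); last first.
    by apply: eq_bigr => j /negPf ji; rewrite !mxE ji.
  rewrite -mulrDl; congr (_ * p); rewrite !mxE eqxx.
  rewrite !maxEle !minEle; do !case: ifP => /=; lra.
rewrite (eq_eseriesr (g := fun k =>
  (boxvol (a k) (lo k))%:E + (boxvol (hi k) (b k))%:E)%E); last first.
  by move=> k _; rewrite vE EFinD.
rewrite nneseriesD; try by move=> k _ _; rewrite lee_fin boxvol_ge0.
apply: leeD; apply: ereal_inf_lbound.
  exists a, lo; split=> // x [/Xab[k _ abx] /Hle xc]; exists k => // j; rewrite mxE.
  by have /andP[ax xb] := abx j; rewrite ax/=; case: eqP => // ?; subst j; rewrite le_min xb xc.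
exists hi, b; split=> // x [/Xab[k _ abx] nHx]; exists k => // j; rewrite mxE.
have /andP[ax xb] := abx j; rewrite xb andbT; case: eqP => // ?; subst j; rewrite ge_max ax/=.
by rewrite leNgt; apply/negP => /ltH.
Qed.

(** * Similarities *)

(** This family contains the group elements ([l = 1]) and the homotheties, and it is closed under
    inversion, so a scaling inequality for all its members is already an equality. *)
Definition simil {R : realType} {d} (l : R) (s : {ffun 'I_d -> bool})
  (sg : {perm 'I_d}) (v x : vec R d) : vec R d := l *: Wact s sg x + v.

Lemma simil_inverse {R : realType} {d} (l : R) s sg (v : vec R d) : l != 0 ->
  exists s' sg' v', cancel (simil l s sg v) (simil l^-1 s' sg' v') /\
                    cancel (simil l^-1 s' sg' v') (simil l s sg v).
Proof.
move=> l0; exists [ffun j => s (sg^-1%g j)], sg^-1%g.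
exists (\row_j - (l^-1 * ((-1) ^+ s (sg^-1%g j) * v 0 (sg^-1%g j)))).
split=> x; apply/rowP => j; rewrite !mxE ?ffunE ?mxE.
  by rewrite permKV; case: (s _); rewrite ?expr1 ?expr0; field.
by rewrite permK; case: (s _); rewrite ?expr1 ?expr0; field.
Qed.

Lemma lebesgue_outer_simil_le {R : realType} {d} (l : R) s sg (v : vec R d)
    (A : set (vec R d)) : 0 < l ->
  ((l ^+ d)%:E * lebesgue_outer (simil l s sg v @^-1` A) <= lebesgue_outer A)%E.
Proof.
move=> l0; apply: le_ereal_inf_tmp => _ [a [b [Aab ->]]].
(* [lo p q] and [hi p q] are the corners of the preimage of [box p q]; a sign change in a coordinate
   exchanges the two ends of its interval. *)
pose lo (p q : vec R d) : vec R d := \row_j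
  let i := sg^-1%g j in (if s i then v 0 i - q 0 i else p 0 i - v 0 i) / l.
pose hi (p q : vec R d) : vec R d := \row_j
  let i := sg^-1%g j in (if s i then v 0 i - p 0 i else q 0 i - v 0 i) / l.
have vE p q : l ^+ d * boxvol (lo p q) (hi p q) = boxvol p q.
  rewrite /boxvol -[in X in X * _](card_ord d) -prodr_const -big_split/=.
  rewrite (reindex_inj (@perm_inj _ sg))/=; apply: eq_bigr => i _.
  rewrite !mxE permK maxr_pMr ?ltW// mulr0 -mulrBl mulrCA mulfV ?gt_eqF// mulr1.
  by case: (s i) => //; congr Num.max; ring.
rewrite -lee_pdivlMl ?exprn_gt0//.
apply: (@le_trans _ _ (\sum_(0 <= k <oo) (boxvol (lo (a k) (b k)) (hi (a k) (b k)))%:E)%E).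
  apply: ereal_inf_lbound; exists (fun k => lo (a k) (b k)), (fun k => hi (a k) (b k)).
  split=> // x /Aab[k _ abx]; exists k => // j.
  have := abx (sg^-1%g j); rewrite !mxE permKV ler_pdivrMr// ler_pdivlMr// mulrC.
  by case: (s _) => /andP[]; rewrite ?expr1 ?expr0 => ? ?; apply/andP; split; lra.
rewrite -nneseriesZl; last by move=> k _; rewrite lee_fin boxvol_ge0.
apply: lee_nneseries => [k _ _|k _]; first by rewrite lee_fin boxvol_ge0.
by rewrite -(vE (a k)) -EFinM lee_fin mulKf// expf_neq0// gt_eqF.
Qed.

Lemma lebesgue_outer_simil {R : realType} {d} (l : R) s sg (v : vec R d)
    (A : set (vec R d)) : 0 < l ->
  ((l ^+ d)%:E * lebesgue_outer (simil l s sg v @^-1` A))%E = lebesgue_outer A.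
Proof.
move=> l0; apply/le_anti; rewrite lebesgue_outer_simil_le//=.
have [s' [sg' [v' [_ K]]]] := simil_inverse l s sg v (lt0r_neq0 l0).
rewrite -lee_pdivrMl ?exprn_gt0// -exprVn.
apply: le_trans (lebesgue_outer_simil_le l^-1 s' sg' v' _ _); last by rewrite invr_gt0.
by rewrite (_ : _ @^-1` _ = A)//; apply/seteqP; split=> x /=; rewrite K.
Qed.

Lemma GactE {R : realType} {d} (g : Gelt d) :
  Gact (R := R) g = simil 1 g.1.1 g.1.2 (zvec R g.2).
Proof. by apply/funext => x; rewrite /simil scale1r. Qed.

Lemma lebesgue_outer_Gact {R : realType} {d} (g : Gelt d) (A : set (vec R d)) :
  lebesgue_outer (Gact g @^-1` A) = lebesgue_outer A.
Proof.
by rewrite GactE -(lebesgue_outer_simil 1 g.1.1 g.1.2 (zvec R g.2) A)// expr1n mul1e.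
Qed.

(** The motion is bijective and preserves the outer measure, so a test set [X] for the preimage is
    transported to a test set for [A]. *)
Lemma caratheodory_Gact {R : realType} {d} (g : Gelt d.+1) (A : set (vec R d.+1)) :
  (lmeas R d).-caratheodory A -> (lmeas R d).-caratheodory (Gact g @^-1` A).
Proof.
move=> mA X; have [s' [sg' [v' [K K']]]] :=
  simil_inverse 1 g.1.1 g.1.2 (zvec R g.2) (oner_neq0 R).
have XE : X = Gact g @^-1` (simil 1^-1 s' sg' v' @^-1` X).
  by apply/seteqP; split=> x /=; rewrite GactE K.
have -> : X `&` Gact g @^-1` A = Gact g @^-1` ((simil 1^-1 s' sg' v' @^-1` X) `&` A).
  by rewrite {1}XE.
have -> : X `&` ~` (Gact g @^-1` A) = Gact g @^-1` ((simil 1^-1 s' sg' v' @^-1` X) `&` ~` A).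
  by rewrite {1}XE.
have inv B : lmeas R d (Gact g @^-1` B) = lmeas R d B by exact: lebesgue_outer_Gact.
by rewrite [in LHS]XE !inv; exact: mA.
Qed.

(** * Volume of the unit cube *)

Lemma integral_itv_indic {R : realType} (p q : R) :
  (\int[lebesgue_measure]_(t in `[0%R, 1%R[) (\1_(`[p, q]) t)%:E <= (Num.max (q - p) 0)%:E)%E.
Proof.
rewrite integral_indic//.
apply: (@le_trans _ _ (lebesgue_measure (`[p, q]%classic : set R))).
  by apply: le_measure => //; rewrite inE//; exact: measurableI.
rewrite lebesgue_measure_itv/= lte_fin; case: ifPn => pq; last first.
  by rewrite lee_fin le_max lexx orbT.
by rewrite -EFinB lee_fin le_max lexx.
Qed.

(* Integrating the hypothesis over one coordinate replaces the factor
   [\1_(`[a k n, b k n])] by the length of that interval. *)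
Lemma cube_cover_volume {R : realType} (n : nat) (a b : nat -> nat -> R) (c : nat -> R) :
  (forall k, 0 <= c k) ->
  (forall x : nat -> R, (forall i, (i < n)%N -> 0 <= x i < 1) ->
    (1 <= \sum_(0 <= k <oo) (c k * \prod_(i < n) \1_(`[a k i, b k i]) (x i))%:E)%E) ->
  (1 <= \sum_(0 <= k <oo) (c k * \prod_(i < n) Num.max (b k i - a k i) 0)%:E)%E.
Proof.
elim: n c => [|n IH] c c0 cover.
  have := cover (fun=> 0) (fun i => ltac:(by [])).
  by under eq_eseriesr do rewrite big_ord0; under [in X in _ -> X]eq_eseriesr do rewrite big_ord0.
(* The length of the last interval is absorbed into the coefficient [c], which is arbitrary in the
   induction hypothesis for this purpose. *)
under eq_eseriesr do rewrite big_ord_recr/= (mulrC (\prod_(i < n) _)) mulrA.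
apply: IH => [k|x x01]; first by rewrite mulr_ge0// le_max lexx orbT.
(* The first [n] coordinates are frozen at [x] and the last one runs through [[0, 1[]. *)
pose upd t i := if i == n then t else x i.
pose e k := c k * \prod_(i < n) \1_(`[a k i, b k i]) (x i).
have e0 k : 0 <= e k by rewrite mulr_ge0// prodr_ge0.
have {}cover t : `[0, 1[%classic t ->
    (1 <= \sum_(0 <= k <oo) ((e k)%:E * (\1_(`[a k n, b k n]) t)%:E))%E.
  move=> /=; rewrite in_itv/= => t01.
  have /cover : forall i, (i < n.+1)%N -> 0 <= upd t i < 1.
    move=> i; rewrite ltnS leq_eqVlt /upd; case: eqP => //= _; exact: x01.
  congr (_ <= _)%E; apply: eq_eseriesr => k _; rewrite -EFinM /e; congr EFin.
  rewrite big_ord_recr/= /upd eqxx mulrA; congr (_ * _ * _).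
  by apply: eq_bigr => i _; rewrite ltn_eqF.
have int1 : (\int[lebesgue_measure]_(t in `[0%R, 1%R[) (cst 1%E t : \bar R) = 1)%E.
  rewrite integral_cst// mul1e.
  have := lebesgue_measure_itv (`[0%R, 1%R[%R : interval R).
  by rewrite /= lte_fin ltr01 oppr0 adde0.
rewrite -[leLHS]int1.
apply: (@le_trans _ _ (\int[lebesgue_measure]_(t in `[0%R, 1%R[)
    \sum_(0 <= k <oo) ((e k)%:E * (\1_(`[a k n, b k n]) t)%:E))%E).
  apply: ge0_le_integral => //.
  - apply: ge0_emeasurable_sum => [k t _ _|k _]; first by rewrite -EFinM lee_fin mulr_ge0.
    by apply: measurable_funeM; apply/measurable_EFinP; exact: measurable_indic.
rewrite integral_nneseries//; last 2 first.
- move=> k; apply: measurable_funeM; apply/measurable_EFinP; exact: measurable_indic.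
- by move=> k t _; rewrite -EFinM lee_fin mulr_ge0.
apply: lee_nneseries => [k _ _|k _].
  by apply: integral_ge0 => t _; rewrite -EFinM lee_fin mulr_ge0.
rewrite ge0_integralZl_EFin//; last first.
  by apply/measurable_EFinP; exact: measurable_indic.
apply: (le_trans (lee_wpmul2l _ (integral_itv_indic _ _))); first by rewrite lee_fin.
by rewrite -EFinM lee_fin /e mulrAC.
Qed.

(** Half-open, so that its integer translates partition the space with no overlap, not even a null
    one. *)
Definition unit_cube (R : realType) d : set (vec R d) :=
  [set x | forall i, 0 <= x 0 i < 1].

(** The substance is the lower bound: the indicators of a covering family of boxes sum to at least 1
    on the cube, and integrating one coordinate at a time bounds the total volume. Positivity of
    ball volumes rests on this. *)
Lemma lebesgue_outer_unit_cube {R : realType} {d} :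
  lebesgue_outer (unit_cube R d.+1) = 1%E.
Proof.
apply/le_anti/andP; split.
  apply: (@le_trans _ _ (lebesgue_outer (box 0 (const_mx 1)))).
    apply: lebesgue_outer_mono => x x01 i; rewrite !mxE.
    by have /andP[-> /ltW] := x01 i.
  apply: (le_trans (lebesgue_outer_box _ _)).
  by rewrite /boxvol big1// => i _; rewrite !mxE subr0; apply/max_idPl.
apply: le_ereal_inf_tmp => _ [a [b [cover ->]]].
pose f (u : vec R d.+1) (i : nat) : R := u 0 (inord i).
have := @cube_cover_volume R d.+1 (fun k => f (a k)) (fun k => f (b k)) (fun=> 1) (fun=> ler01).
set S := (X in _ -> (_ <= X)%E); suff -> : S = (\sum_(0 <= k <oo) (boxvol (a k) (b k))%:E)%E.
  apply=> x x01; have [k _ abx] : (\bigcup_k box (a k) (b k)) (\row_i x i).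
    by apply: cover => i; rewrite mxE x01.
  rewrite (@nneseriesD1 _ _ k xpredT)//; last by move=> j _; rewrite lee_fin mul1r prodr_ge0.
  rewrite mul1r big1 ?leeDl//.
    by apply: nneseries_ge0 => j _ _; rewrite lee_fin mul1r prodr_ge0.
  move=> i _; rewrite indicE mem_set//= in_itv/= /f inord_val.
  by have := abx i; rewrite mxE.
apply: eq_eseriesr => k _; congr EFin; rewrite mul1r; apply: eq_bigr => i _.
by rewrite /f inord_val.
Qed.

(** * Borel sets and double counting *)

Lemma caratheodory_box {R : realType} {d} (a b : vec R d.+1) :
  (lmeas R d).-caratheodory (box a b).
Proof.
pose T := caratheodory_type (lmeas R d).
have -> : box a b = \bigcap_(i in [set: 'I_d.+1])
    ((~` [set x : vec R d.+1 | x 0 i < a 0 i]) `&` [set x : vec R d.+1 | x 0 i <= b 0 i]).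
  apply/seteqP; split=> x /= h i.
    by move=> _; have /andP[ai ?] := h i; split=> //; apply/negP; rewrite -leNgt.
  by have [/negP] := h i Logic.I; rewrite -leNgt => -> /= ->.
apply: (@fin_bigcap_measurable _ T) => // i _; apply: (@measurableI _ T).
  by apply: (@measurableC _ T); apply: (@caratheodory_halfspace _ _ i (a 0 i)) => x // /ltW.
by apply: (@caratheodory_halfspace _ _ i (b 0 i)) => x // /ltW.
Qed.

(** An open set is the union of the grid cubes, of mesh 1 / (n + 1) for varying [n], that it
    contains; these are countably many. *)
Lemma caratheodory_open {R : realType} {d} (U : set 'rV[R]_d.+1) : open U ->
  (lmeas R d).-caratheodory U.
Proof.
move=> oU; pose T := caratheodory_type (lmeas R d).
pose cell (p : nat * 'rV[int]_d.+1) : set (vec R d.+1) :=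
  box (\row_i ((p.2 0 i)%:~R / p.1.+1%:R)) (\row_i (((p.2 0 i)%:~R + 1) / p.1.+1%:R)).
have -> : U = \bigcup_(p in [set: nat * 'rV[int]_d.+1])
    (if `[< cell p `<=` U >] then cell p else set0).
  apply/seteqP; split=> [x Ux|x [p _]]; last by case: asboolP => // sub /sub.
  have /nbhs_ballP[e /= e0 xeU] : nbhs x U by rewrite nbhsE/=; exists U.
  (* The mesh is below [e], so the grid cube around [x] stays in the sup-norm ball of radius [e]. *)
  pose n := Num.trunc (e^-1).
  have ne : n.+1%:R^-1 < e by rewrite invf_plt ?posrE// /n truncnS_gt.
  have bnd (i : 'I_d.+1) : (Num.floor (x 0 i * n.+1%:R))%:~R / n.+1%:R <= x 0 i <=
      ((Num.floor (x 0 i * n.+1%:R))%:~R + 1) / n.+1%:R.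
    rewrite ler_pdivrMr// ler_pdivlMr// floor_le/=.
    by have := ltW (floorD1_gt (x 0 i * n.+1%:R)); rewrite intrD.
  exists (n, \row_i Num.floor (x 0 i * n.+1%:R)) => //.
  rewrite asboolT; first by move=> i; rewrite !mxE; exact: bnd.
  move=> y cy; apply: xeU; split=> // i j; rewrite ord1.
  have := cy j; rewrite !mxE mulrDl mul1r => /andP[y1 y2].
  have := bnd j; rewrite mulrDl mul1r => /andP[x1 x2].
  rewrite /ball/= ltr_norml; move: ne x1 x2 y1 y2 => /=.
  set p := _%:~R / _; set q := n.+1%:R^-1.
  by move: p q => p q *; apply/andP; split; lra.
apply: (@countable_bigcupT_measurable _ T); first exact: countableP.
move=> p; case: ifP => _; first exact: caratheodory_box.
exact: (@measurable0 _ T).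
Qed.

Lemma caratheodory_closed {R : realType} {d} (F : set 'rV[R]_d.+1) : closed F ->
  (lmeas R d).-caratheodory F.
Proof.
move=> cF; rewrite -(setCK F); apply: caratheodory_measurable_setC.
by apply: caratheodory_open; exact: closed_openC.
Qed.

Lemma continuous_sum {R : realType} {T : topologicalType} {V : normedModType R}
    (I : Type) (r : seq I) (f : I -> T -> V) :
  (forall i, continuous (f i)) -> continuous (fun x => \sum_(i <- r) f i x).
Proof.
move=> cf; elim: r => [|i r IH] x.
  by under eq_fun do rewrite big_nil; exact: cvg_cst.
under eq_fun do rewrite big_cons.
by apply: cvgD; [exact: cf|exact: IH].
Qed.

(** The ball is Euclidean while the topology of row vectors is that of the sup norm, so openness
    goes through continuity of [sqnorm]. *)
Lemma open_eball {R : realType} {d} (x : vec R d) r : open (eball x r : set 'rV[R]_d).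
Proof.
have cont : continuous (fun y : 'rV[R]_d => sqnorm (y - x)).
  apply: continuous_sum => i y.
  rewrite /=; under eq_fun do rewrite !mxE expr2.
  have h : (fun z : 'rV[R]_d => z 0 i - x 0 i) z @[z --> y] --> y 0 i - x 0 i.
    exact: (cvgB (@coord_continuous R 1 d 0 i y) (cvg_cst _)).
  exact: (cvgM h h).
have -> : eball x r = (fun y : 'rV[R]_d => sqnorm (y - x)) @^-1` [set t | t < r ^+ 2] by [].
by apply: open_comp => [y _|]; [exact: cont|exact: open_lt].
Qed.

(** Both sides are the integral over [B] of the sum of the indicators of the sets [A i]. *)
Lemma double_counting {R : realType} {d} (I : finType) (B N : set (vec R d.+1))
    (A : I -> set (vec R d.+1)) (c : R) :
  (lmeas R d).-caratheodory B -> (forall i, (lmeas R d).-caratheodory (A i)) ->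
  lebesgue_outer N = 0%E ->
  (forall x, B x -> ~ N x -> \sum_i \1_(A i) x = c) ->
  (\sum_i lebesgue_outer (B `&` A i) = c%:E * lebesgue_outer B)%E.
Proof.
move=> mB mA N0 sum_c.
pose T := caratheodory_type (lmeas R d).
pose mu : {measure set T -> \bar R} := (lmeas R d : set T -> \bar R).
have mBT : measurable (B : set T) by exact: mB.
have mAT i : measurable (A i : set T) by exact: mA.
have mf i : measurable_fun (B : set T) (EFin \o (\1_(A i) : T -> R)).
  by apply/measurable_EFinP; exact: measurable_indic.
transitivity (\int[mu]_(x in B) \sum_i (\1_(A i) x : R)%:E)%E.
  rewrite ge0_integral_sum//.
  by apply: eq_bigr => i _; rewrite setIC integral_indic.
rewrite -[RHS](@integral_cst _ _ _ mu)//; apply: ae_eq_integral => //.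
  exact: emeasurable_sum.
exists N; split => //.
  (* A set of outer measure zero is Caratheodory measurable, so [N] qualifies as an exceptional
     set. *)
  apply: le_caratheodory_measurable => X.
  have -> : lmeas R d (X `&` N) = 0%E.
    apply/le_anti; rewrite lebesgue_outer_ge0 andbT -N0.
    exact: lebesgue_outer_mono.
  by rewrite add0e; exact: lebesgue_outer_mono.
move=> x /= nx; apply: contrapT => Nx; apply: nx => Bx.
by rewrite sumEFin sum_c.
Qed.

(** * Lattice polytopes are compact and locally conic *)

Definition l1norm {R : realType} {d} (z : 'rV[R]_d) : R := \sum_(j < d) `|z 0 j|.

(* Caratheodory's argument: a dependency among the generators indexed by [S]
   lets one of them be dropped, and on an independent family the coefficients
   depend linearly on the vector. *)
Lemma conic_representation_bound {R : realType} {N d} (U : 'M[R]_(N, d)) (S : {set 'I_N}) :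
  exists2 K : R, 0 <= K & forall c : 'rV[R]_N,
    (forall i, 0 <= c 0 i) -> (forall i, i \notin S -> c 0 i = 0) ->
    exists c' : 'rV[R]_N, [/\ forall i, 0 <= c' 0 i, c' *m U = c *m U
      & \sum_i c' 0 i <= K * l1norm (c *m U)].
Proof.
have [n] := ubnP #|S|; elim: n S => // n IH S /ltnSE leSn.
have [indep|dep] := pselect (forall m : 'rV[R]_N,
    (forall i, i \notin S -> m 0 i = 0) -> m *m U = 0 -> m = 0).
  pose A : 'M[R]_(N, d) := \matrix_(i, j) if i \in S then U i j else 0.
  have mulA (c : 'rV[R]_N) :
      c *m A = (\row_i if i \in S then c 0 i else 0) *m U.
    apply/rowP => j; rewrite !mxE; apply: eq_bigr => i _; rewrite !mxE.
    by case: ifP; rewrite ?mulr0 ?mul0r.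
  exists (\sum_j \sum_i `|pinvmx A j i|).
    by apply: sumr_ge0 => j _; apply: sumr_ge0.
  move=> c c0 cS; exists c; split=> //.
  have maskc : (\row_i if i \in S then c 0 i else 0) = c.
    by apply/rowP => i; rewrite mxE; case: ifPn => // /cS.
  have cA : c *m A = c *m U by rewrite mulA maskc.
  pose c1 := c *m U *m pinvmx A.
  have c1A : c1 *m A = c *m U by rewrite /c1 mulmxKpV// -cA submxMl.
  have cE i : c 0 i = if i \in S then c1 0 i else 0.
    have /indep : forall i, i \notin S -> (c - \row_i if i \in S then c1 0 i else 0) 0 i = 0.
      by move=> k kS; rewrite !mxE (negbTE kS) cS// subr0.
    rewrite mulmxBl -mulA c1A subrr => /(_ erefl)/rowP/(_ i).
    by rewrite !mxE => /eqP; rewrite subr_eq0 => /eqP.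
  apply: (@le_trans _ _ (\sum_i \sum_j `|(c *m U) 0 j| * `|pinvmx A j i|)).
    apply: ler_sum => i _; rewrite cE; case: ifP => _; last first.
      by apply: sumr_ge0 => j _; rewrite mulr_ge0.
    rewrite /c1 mxE; apply: ler_sum => j _; rewrite -normrM; exact: ler_norm.
  rewrite exchange_big/= mulr_suml; apply: ler_sum => j _.
  rewrite -mulr_sumr mulrC; apply: ler_wpM2l; first by apply: sumr_ge0.
  by rewrite /l1norm (bigD1 j)//= lerDl sumr_ge0.
have [m [mS mU [i1 mi1]]] : exists m : 'rV[R]_N,
    [/\ forall i, i \notin S -> m 0 i = 0, m *m U = 0 & exists i, 0 < m 0 i].
  move/existsNP: dep => [m /not_implyP[mS /not_implyP[mU m0]]].
  have /rV0Pn[k mk0] : m != 0 by apply/eqP.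
  move: mk0; rewrite neq_lt => /orP[mk|mk]; last by exists m; split=> //; exists k.
  exists (- m); split.
  - by move=> i iS; rewrite mxE mS// oppr0.
  - by rewrite mulNmx mU oppr0.
  - by exists k; rewrite mxE oppr_gt0.
have /choice[K KP] : forall i, exists K : R, 0 <= K /\ (i \in S -> forall c : 'rV[R]_N,
    (forall i, 0 <= c 0 i) -> (forall k, k \notin S :\ i -> c 0 k = 0) ->
    exists c' : 'rV[R]_N, [/\ forall i, 0 <= c' 0 i, c' *m U = c *m U
      & \sum_i c' 0 i <= K * l1norm (c *m U)]).
  move=> i; have [iS|_] := boolP (i \in S); last by exists 0.
  have [|K K0 KP] := IH (S :\ i); last by exists K; split.
  by move: leSn; rewrite (cardsD1 i) iS.
exists (\sum_i K i); first by apply: sumr_ge0 => i _; case: (KP i).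
move=> c c0 cS.
(* The least ratio is the largest [t] for which [c - t *: m] stays nonnegative, and the entry [i0]
   then vanishes. *)
have [i0 /= mi0 mini0] := @arg_minP _ _ _ i1 (fun i => 0 < m 0 i) (fun i => c 0 i / m 0 i) mi1.
pose t := c 0 i0 / m 0 i0.
have t0 : 0 <= t by rewrite divr_ge0// ltW.
have i0S : i0 \in S by apply: contraTT mi0 => /mS ->; rewrite ltxx.
have [_ /(_ i0S (c - t *: m))] := KP i0.
have -> : (c - t *: m) *m U = c *m U by rewrite mulmxBl -scalemxAl mU scaler0 subr0.
case.
- move=> i; rewrite !mxE subr_ge0; have [mi|mi] := ltP 0 (m 0 i).
    by rewrite -ler_pdivlMr//; exact: mini0.
  by apply: (le_trans _ (c0 i)); rewrite mulr_ge0_le0.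
- move=> i; rewrite !inE negb_and negbK !mxE => /orP[/eqP ->|iS].
    by rewrite /t mulfVK ?subrr// gt_eqF.
  by rewrite cS// mS// mulr0 subr0.
move=> c' [c'0 c'U c'K]; exists c'; split=> //; apply: (le_trans c'K).
apply: ler_wpM2r; first exact: sumr_ge0.
by rewrite (bigD1 i0)//= lerDl; apply: sumr_ge0 => i _; case: (KP i).
Qed.

(** Under this condition the ratio in [solid_angle] is the same for all radii below [r0], so the
    value chosen by [xget] is the intended one. *)
Definition locally_conic {R : realType} {d} (P : set (vec R d)) (x : vec R d) (r0 : R) :=
  forall (y : vec R d) (t : R), 0 < t <= 1 -> sqnorm y < r0 ^+ 2 ->
    P (x + y) <-> P (x + t *: y).

Lemma sqnorm_coord {R : realType} {d} (y : vec R d) r : 0 <= r -> sqnorm y < r ^+ 2 ->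
  forall i, `|y 0 i| < r.
Proof.
move=> r0 yr i; rewrite -(ger0_norm r0) -ltr_sqr// ?nnegrE// !real_normK ?num_real//.
apply: le_lt_trans yr; rewrite /sqnorm (bigD1 i)//= lerDl.
by apply: sumr_ge0 => j _; exact: sqr_ge0.
Qed.

Section hull.
Variables (R : realType) (d : nat) (V : seq 'rV[int]_d).
Let P : set 'rV[R]_d := lattice_hull (R := R) V.
Let v i : 'rV[R]_d := zvec R (tnth (in_tuple V) i).

Lemma compact_lattice_hull : compact P.
Proof.
pose simplex : set 'rV[R]_(size V) :=
  [set l | (forall i, 0 <= l 0 i) /\ \sum_i l 0 i = 1].
pose f (l : 'rV[R]_(size V)) : 'rV[R]_d := \sum_i l 0 i *: v i.
have -> : P = f @` simplex.
  apply/seteqP; split=> [x [l [l0 [l1 ->]]]|_ [l [l0 l1] <-]]; last first.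
    by exists (fun i => l 0 i).
  exists (\row_i l i); last by apply: eq_bigr => i _; rewrite mxE.
  by split=> [i|]; [rewrite mxE|rewrite -[RHS]l1; apply: eq_bigr => i _; rewrite mxE].
have coordc i : continuous (fun l : 'rV[R]_(size V) => l 0 i).
  exact: coord_continuous.
apply: continuous_compact.
  apply: continuous_subspaceT; apply: continuous_sum => i l.
  exact: (cvgZr_tmp (@coord_continuous R 1 (size V) 0 i l)).
apply: (@subclosed_compact _ _ [set l : 'rV[R]_(size V) | forall i, `[0, 1]%classic (l ord0 i)]).
- have -> : simplex = (\bigcap_(i in [set: 'I_(size V)])
      ((fun l : 'rV[R]_(size V) => l 0 i) @^-1` [set t | 0 <= t])) `&`
     ((fun l : 'rV[R]_(size V) => \sum_i l 0 i) @^-1` [set 1]).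
    apply/seteqP; split=> l [l0 l1]; split=> // i; last exact: l0.
    by move=> _; exact: l0.
  apply: closedI.
    apply: closed_bigI => i _; apply: preimage_closed; last exact: closed_ge.
    by move=> l _; exact: coordc.
  apply: preimage_closed; last exact: closed_eq.
  by move=> l _; exact: continuous_sum.
- by apply: (@rV_compact R _ (fun=> `[0, 1]%classic)) => i; exact: segment_compact.
move=> l [l0 l1] i /=; rewrite in_itv/= l0/= -l1 (bigD1 i)//= lerDl.
exact: sumr_ge0.
Qed.

Lemma closed_lattice_hull : closed P.
Proof. by apply: compact_closed; [exact: norm_hausdorff|exact: compact_lattice_hull]. Qed.

Lemma lattice_hull_bounded : exists M : nat, forall x : vec R d, P x -> forall i, `|x 0 i| <= M%:R.
Proof.
pose M := \sum_i \sum_j `|v i 0 j|.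
exists (Num.trunc M).+1 => x [l [l0 [l1 ->]]] j.
apply: (le_trans _ (ltW (truncnS_gt _))).
rewrite summxE; apply: (le_trans (ler_norm_sum _ _ _)); apply: ler_sum => i _.
have li : l i <= 1 by rewrite -l1 (bigD1 i)//= lerDl sumr_ge0.
rewrite mxE normrM (ger0_norm (l0 i)) (bigD1 j)//=.
apply: (@le_trans _ _ `|v i 0 j|); first by rewrite ler_piMl.
by rewrite lerDl sumr_ge0.
Qed.

(** With [s] the sum of the [c i], the new point is (1 - s) x + sum of c_i v_i, a convex combination
    of [x] and the vertices. *)
Lemma lattice_hull_add (x : vec R d) (c : 'I_(size V) -> R) : P x ->
  (forall i, 0 <= c i) -> \sum_i c i <= 1 -> P (x + \sum_i c i *: (v i - x)).
Proof.
move=> [l [l0 [l1 xE]]] c0 c1; set s := \sum_i c i in c1.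
exists (fun i => (1 - s) * l i + c i); split; [|split].
- by move=> i; rewrite addr_ge0// mulr_ge0// subr_ge0.
- by rewrite big_split/= -mulr_sumr l1 mulr1 -/s subrK.
under eq_bigr do rewrite scalerBr; rewrite sumrB -scaler_suml -/s.
under [in RHS]eq_bigr do rewrite scalerDl -scalerA; rewrite big_split/= -scaler_sumr -xE.
by rewrite scalerBl scale1r addrA addrAC.
Qed.

(** At a point of [P], if [x + t *: y] is in [P] then [y] lies in the cone spanned by the [v i - x].
    [conic_representation_bound] rewrites [y] with coefficients of total at most [K * l1norm y]; for
    short [y] this is at most 1 and [x + y] is in [P]. Off [P], closedness gives a ball that misses
    [P]. *)
Lemma lattice_hull_conic (x : vec R d) : exists2 r0 : R, 0 < r0 & locally_conic P x r0.
Proof.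
have [Px|nPx] := pselect (P x); last first.
  have /closed_openC oC := closed_lattice_hull.
  have /nbhs_ballP[e /= e0 xeP] : nbhs (x : 'rV[R]_d) (~` P) by rewrite nbhsE/=; exists (~` P).
  exists e => // y t /andP[t0 t1] ye.
  have far (z : vec R d) : (forall i, `|z 0 i| < e) -> ~ P (x + z).
    move=> ze; apply: xeP; split=> // i j; rewrite ord1 /ball/= !mxE.
    rewrite opprD addrA subrr sub0r normrN.
    exact: ze.
  have ye' := sqnorm_coord _ _ (ltW e0) ye.
  split=> [/(far _ ye') //|]; apply: contraPP => _; apply: far => i; rewrite mxE normrM gtr0_norm//.
  by apply: le_lt_trans (ye' i); rewrite ler_piMl.
pose U : 'M[R]_(size V, d) := \matrix_i (v i - x).
have mulU (c : 'rV[R]_(size V)) : c *m U = \sum_i c 0 i *: (v i - x).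
  by rewrite mulmx_sum_row; apply: eq_bigr => i _; rewrite rowK.
have [K K0 KP] := conic_representation_bound U [set: 'I_(size V)].
(* Then [l1norm y <= d * r0], which gives a total of at most [K * d * r0 <= 1]; the added 1 keeps
   the denominator positive when [K = 0]. *)
pose r0 := (K * d%:R + 1)^-1.
have Kd : 0 < K * d%:R + 1 by rewrite ltr_wpDl// mulr_ge0.
have r00 : 0 < r0 by rewrite invr_gt0.
exists r0 => // y t /andP[t0 t1] yr; split.
  move=> [l [l0 [l1 xyE]]].
  have -> : t *: y = \sum_i (t * l i) *: (v i - x).
    under eq_bigr do rewrite scalerBr -!scalerA; rewrite sumrB -!scaler_sumr -scaler_suml l1 scale1r.
    by rewrite -xyE -scalerBr addrAC subrr add0r.
  apply: lattice_hull_add => // [i|]; first by rewrite mulr_ge0// ltW.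
  by rewrite -mulr_sumr l1 mulr1.
move=> [l [l0 [l1 xyE]]].
have yE : y = (\row_i (t^-1 * l i)) *m U.
  rewrite mulU; under eq_bigr do rewrite mxE scalerBr -!scalerA.
  rewrite sumrB -!scaler_sumr -scaler_suml l1 scale1r -xyE -scalerBr addrAC subrr add0r.
  by rewrite scalerA mulVf ?scale1r// gt_eqF.
have [||c' [c'0 c'U c'K]] := KP (\row_i (t^-1 * l i)).
- by move=> i; rewrite mxE mulr_ge0// invr_ge0 ltW.
- by move=> i; rewrite inE.
rewrite yE -c'U mulU; apply: lattice_hull_add => //.
rewrite -yE in c'K; apply: (le_trans c'K).
apply: (@le_trans _ _ (K * (d%:R * r0))).
  apply: ler_wpM2l => //; rewrite /l1norm.
  apply: (@le_trans _ _ (\sum_(j < d) r0)); last by rewrite sumr_const card_ord mulr_natl.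
  by apply: ler_sum => j _; exact: ltW (sqnorm_coord _ _ (ltW r00) yr j).
by rewrite mulrA /r0 ler_pdivrMr// mul1r lerDl.
Qed.

End hull.

(** * Solid angles *)

Lemma fineZ {R : realType} (k : R) (X : \bar R) : 0 < k -> fine (k%:E * X) = k * fine X.
Proof. by move=> k0; case: X => [x| |] //=; rewrite ?gt0_muley ?gt0_muleNy ?lte_fin//= mulr0. Qed.

Lemma lebesgue_outer_fin {R : realType} {d} (M : R) (A : set (vec R d.+1)) :
  (forall x : vec R d.+1, A x -> forall i, `|x 0 i| <= M) -> lebesgue_outer A \is a fin_num.
Proof.
move=> AM; rewrite ge0_fin_numE; last exact: lebesgue_outer_ge0.
apply: (@le_lt_trans _ _ (lebesgue_outer (box (const_mx (- M)) (const_mx M : vec R d.+1)))).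
  by apply: lebesgue_outer_mono => x /AM xM i; rewrite !mxE -ler_norml.
by apply: (le_lt_trans (lebesgue_outer_box _ _)); rewrite ltry.
Qed.

Lemma lebesgue_outer_eball_fin {R : realType} {d} (x : vec R d.+1) (r : R) (A : set (vec R d.+1)) :
  0 <= r -> A `<=` eball x r -> lebesgue_outer A \is a fin_num.
Proof.
move=> r0 Ax; apply: (lebesgue_outer_fin (r + l1norm x) A) => y /Ax yx i.
have yr := sqnorm_coord _ _ r0 yx.
rewrite -(subrK (x 0 i) (y 0 i)); apply: (le_trans (ler_normD _ _)); apply: lerD.
  by have := yr i; rewrite !mxE => /ltW.
by rewrite /l1norm (bigD1 i)//= lerDl sumr_ge0.
Qed.

Lemma Wact1 {R : realType} {d} (x : vec R d) : Wact [ffun=> false] 1%g x = x.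
Proof. by apply/rowP => i; rewrite mxE ffunE perm1 expr0 mul1r. Qed.

Lemma vol_affine {R : realType} {d} (l : R) (v : vec R d) (A : set (vec R d)) : 0 < l ->
  vol A = l ^+ d * vol ((fun x => l *: x + v) @^-1` A).
Proof.
move=> l0; rewrite /vol -(lebesgue_outer_simil l [ffun=> false] 1%g v A)//.
rewrite fineZ ?exprn_gt0//; congr (_ * fine (lebesgue_outer _)).
by apply/seteqP; split=> x /=; rewrite /simil Wact1.
Qed.

Lemma sqnormZ {R : realType} {d} (t : R) (y : vec R d) : sqnorm (t *: y) = t ^+ 2 * sqnorm y.
Proof. by rewrite /sqnorm mulr_sumr; apply: eq_bigr => i _; rewrite mxE exprMn. Qed.

Lemma eballZ {R : realType} {d} (l r : R) (x y c : vec R d) : 0 < l ->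
  eball (l *: x + c) (l * r) (l *: y + c) = eball x r y.
Proof.
move=> l0; rewrite /eball/= opprD addrACA subrr addr0 -scalerBr sqnormZ exprMn.
by rewrite ltr_pM2l// exprn_gt0.
Qed.

(** The ball contains a translated cube of side s = r / (d + 2), because the squared diameter (d +
    1) s^2 is below r^2. *)
Lemma vol_eball_gt0 {R : realType} {d} (x : vec R d.+1) r : 0 < r -> 0 < vol (eball x r).
Proof.
move=> r0; pose s := r / d.+2%:R.
have s0 : 0 < s by rewrite divr_gt0.
rewrite fine_gt0//; apply/andP; split; last first.
  by rewrite ltey_eq (lebesgue_outer_eball_fin x r)// ltW.
rewrite -(lebesgue_outer_simil s [ffun=> false] 1%g x)//.
rewrite mule_gt0// ?lte_fin ?exprn_gt0//.
apply: (@lt_le_trans _ _ 1%E); first by rewrite lte_fin.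
rewrite -(@lebesgue_outer_unit_cube R d); apply: lebesgue_outer_mono => y y01.
rewrite /= /simil Wact1 /eball/= addrK sqnormZ.
apply: (@le_lt_trans _ _ (s ^+ 2 * d.+1%:R)).
  apply: ler_wpM2l; first exact: sqr_ge0.
  rewrite /sqnorm -[X in _ <= X%:R](card_ord d.+1) -sum1_card natr_sum; apply: ler_sum => i _.
  by have /andP[? /ltW ?] := y01 i; rewrite expr_le1.
rewrite /s exprMn -mulrA -[ltRHS]mulr1 ltr_pM2l ?exprn_gt0//.
rewrite exprVn mulrC ltr_pdivrMr ?exprn_gt0// mul1r expr2 -natrM ltr_nat.
by rewrite mulnS ltn_addr.
Qed.

(** The homothety of centre [x] and ratio [r / r'] carries the larger slice onto the smaller one. *)
Lemma vol_conic {R : realType} {d} (P : set (vec R d)) x r0 r r' :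
  locally_conic P x r0 -> 0 < r <= r' -> r' < r0 ->
  vol (eball x r `&` P) = (r / r') ^+ d * vol (eball x r' `&` P).
Proof.
move=> cP /andP[r_gt0 rr'] r'r0; pose l := r / r'.
have r'_gt0 : 0 < r' by exact: lt_le_trans rr'.
have l0 : 0 < l by rewrite divr_gt0.
have l1 : l <= 1 by rewrite ler_pdivrMr// mul1r.
rewrite (vol_affine l (x - l *: x))//; congr (_ * vol _).
have aff y : l *: y + (x - l *: x) = x + l *: (y - x) by rewrite scalerBr addrCA.
have ball y : eball x r (l *: y + (x - l *: x)) = eball x r' y.
  rewrite -(eballZ l r' x y (x - l *: x))// (_ : l * r' = r) ?divfK ?gt_eqF//.
  by rewrite (addrC (l *: x)) subrK.
have -> : (fun y => l *: y + (x - l *: x)) @^-1` (eball x r `&` P) =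
    [set y | eball x r' y /\ P (x + l *: (y - x))].
  by apply/funext => y; rewrite /preimage/setI/= ball aff.
apply/seteqP; split=> y [yr' Py]; split=> //.
  rewrite -(subrKC x y) (cP _ l) ?l0//.
  by apply: (lt_trans yr'); rewrite ltr_pXn2r ?nnegrE// ltW// (lt_trans r'_gt0).
rewrite -cP ?subrKC ?l0//.
by apply: (lt_trans yr'); rewrite ltr_pXn2r ?nnegrE// ltW// (lt_trans r'_gt0).
Qed.

Lemma solid_angleE {R : realType} {d} (P : set (vec R d.+1)) x r0 r :
  locally_conic P x r0 -> 0 < r < r0 ->
  solid_angle P x = vol (eball x r `&` P) / vol (eball x r).
Proof.
move=> cP; have conicT : locally_conic (@setT (vec R d.+1)) x r0 by move=> y t _ _; split.
have mono p q : 0 < p <= q -> q < r0 ->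
    vol (eball x p `&` P) / vol (eball x p) = vol (eball x q `&` P) / vol (eball x q).
  (* The full ball is the slice of the conic set [setT], so numerator and denominator scale by the
     same factor. *)
  move=> /[dup] pq /andP[p0 /(lt_le_trans p0) q0] qr.
  rewrite (vol_conic P x r0 p q)// -[eball x p]setIT (vol_conic setT x r0 p q)// setIT.
  rewrite -mulf_div divff ?mul1r// expf_neq0// gt_eqF// divr_gt0//.
have const p q : 0 < p < r0 -> 0 < q < r0 ->
    vol (eball x p `&` P) / vol (eball x p) = vol (eball x q `&` P) / vol (eball x q).
  move=> /andP[p0 pr] /andP[q0 qr]; have [pq|/ltW qp] := leP p q; first by apply: mono; rewrite ?p0.
  by apply/esym/mono; rewrite ?q0.
move=> /[dup] r0r /andP[r_gt0 r_lt]; rewrite /solid_angle; apply: xget_subset1.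
  exists r0; split; first exact: lt_trans r_lt.
  by move=> q q0 qr; apply: const => //; rewrite q0.
(* Two candidate values agree because both are the ratio at half the smaller threshold. *)
move=> w w' [p [p0 pw]] [q [q0 qw]].
have m0 : 0 < Num.min p q by rewrite lt_min p0.
have h0 : 0 < Num.min p q / 2 by rewrite divr_gt0.
have hm : Num.min p q / 2 < Num.min p q by rewrite ltr_pdivrMr// ltr_pMr// ltr1n.
rewrite -(pw _ h0) -?(qw _ h0)//.
  by apply: (lt_le_trans hm); rewrite ge_min lexx orbT.
by apply: (lt_le_trans hm); rewrite ge_min lexx.
Qed.

Lemma solid_angle_dilate {R : realType} {d} (P : set (vec R d.+1)) x r0 (n : R) :
  0 < n -> 0 < r0 -> locally_conic P x r0 ->
  solid_angle (dilate n P) (n *: x) = solid_angle P x.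
Proof.
move=> n0 r00 cP.
have dilP y : dilate n P (n *: y) <-> P y.
  split=> [[z Pz]|Py]; last by exists y.
  by move=> /(scalerI (lt0r_neq0 n0)) <-.
have cnP : locally_conic (dilate n P) (n *: x) (n * r0).
  move=> y t t01 ynr.
  have [z yE] : exists z, y = n *: z.
    by exists (n^-1 *: y); rewrite scalerA divff ?scale1r// gt_eqF.
  rewrite yE scalerA (mulrC t) -scalerA -!scalerDr !dilP; apply: cP => //.
  by rewrite -(ltr_pM2l (exprn_gt0 2 n0)) -sqnormZ -yE -exprMn.
pose r := r0 / 2; have r0' : 0 < r < r0.
  by rewrite divr_gt0//= ltr_pdivrMr// ltr_pMr// ltr1n.
have [r_gt0 _] := andP r0'.
rewrite (solid_angleE _ _ _ (n * r) cnP); last by rewrite mulr_gt0// ltr_pM2l//=; case/andP: r0'.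
rewrite (solid_angleE _ _ _ r cP)//.
have pre : (fun y : vec R d.+1 => n *: y + 0) @^-1` (eball (n *: x) (n * r)) = eball x r.
  by apply/funext => y /=; rewrite -[n *: x]addr0 eballZ.
rewrite (vol_affine n 0 (_ `&` dilate n P))// (vol_affine n 0 (eball (n *: x) _))//.
rewrite -mulf_div divff ?mul1r ?expf_neq0 ?gt_eqF// pre; congr (vol _ / _).
rewrite preimage_setI pre; apply/seteqP; split=> y /= [yr]; rewrite addr0.
  by move/dilP.
by move=> Py; split=> //; apply/dilP.
Qed.

Lemma sqnorm_Gact {R : realType} {d} (g : Gelt d) (x y : vec R d) :
  sqnorm (Gact g x - Gact g y) = sqnorm (x - y).
Proof.
rewrite /sqnorm [RHS](reindex_inj (@perm_inj _ g.1.2)); apply: eq_bigr => i _.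
by rewrite !mxE opprD addrACA subrr addr0 -mulrBr exprMn sqrr_sign mul1r.
Qed.

(** Pulling back by the isometry [g] places the solid angles at all the points [Gact g x] in one
    ball around [x], where the tiling identity can be integrated. *)
Lemma solid_angle_Gact {R : realType} {d} (P : set (vec R d.+1)) (g : Gelt d.+1) x r0 r :
  locally_conic P (Gact g x) r0 -> 0 < r < r0 ->
  solid_angle P (Gact g x) = vol (eball x r `&` Gact g @^-1` P) / vol (eball x r).
Proof.
move=> cP rr; rewrite (solid_angleE _ _ _ r cP)//.
have pre : Gact g @^-1` (eball (Gact g x) r) = eball x r.
  by apply/funext => y /=; rewrite /eball/= sqnorm_Gact.
by rewrite -pre -preimage_setI /vol !lebesgue_outer_Gact.
Qed.

(** * Multi-tilings *)

Definition cubept {d} (N : nat) (u : {ffun 'I_d -> 'I_(N.*2.+1)}) : 'rV[int]_d :=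
  \row_i ((u i)%:Z - N%:Z).

Lemma cubept_inj {d} N : injective (@cubept d N).
Proof.
move=> u u' /rowP uu'; apply/ffunP => i; apply/val_inj.
by have := uu' i; rewrite !mxE => /addIr [].
Qed.

Lemma cubeptP {d} N (t : 'rV[int]_d) : (forall i, `|t 0 i| <= N%:Z) ->
  exists u, cubept N u = t.
Proof.
move=> tN; exists [ffun i => inord `|(t 0 i + N%:Z)%R|%N]; apply/rowP => i.
by rewrite !mxE ffunE inordK; have := tN i; lia.
Qed.

Definition gpt {d} (N : nat)
    (p : {ffun 'I_d -> bool} * {perm 'I_d} * {ffun 'I_d -> 'I_(N.*2.+1)}) : Gelt d :=
  (p.1, cubept N p.2).

Lemma gpt_inj {d} N : injective (@gpt d N).
Proof. by move=> [w u] [w' u'] [-> /cubept_inj ->]. Qed.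

Lemma fsbig_range {X : choiceType} {I : finType} {T : zmodType} (e : I -> X) (F : X -> T) :
  injective e -> (forall x, ~ range e x -> F x = 0) ->
  \sum_(x \in [set: X]) F x = \sum_i F (e i).
Proof.
move=> e_inj F0; rewrite (fsbigE (map e (index_enum I)))//.
- rewrite big_map big_mkcond/=; apply: eq_bigr => i _; by rewrite in_setT.
- by rewrite map_inj_uniq// /index_enum -enumT enum_uniq.
move=> x _ xe; apply: F0 => -[i _ ix]; move/negP: xe; apply.
by apply/mapP; exists i => //; rewrite mem_index_enum.
Qed.

Lemma esum_range {R : realType} {X : choiceType} {I : finType} (e : I -> X) (F : X -> R) :
  injective e -> (forall x, 0 <= F x) -> (forall x, ~ range e x -> F x = 0) ->
  \esum_(x in [set: X]) (F x)%:E = (\sum_i F (e i))%:E.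
Proof.
move=> e_inj F_ge0 F0.
transitivity (\esum_(x in range e) (F x)%:E).
  rewrite [RHS]esum_mkcond; apply: eq_esum => x _.
  by case: ifPn => // /negP; rewrite inE => /F0 ->.
rewrite esum_image; last by move=> i j _ _; exact: e_inj.
rewrite esum_fset; [|exact: finite_finset|by move=> i _; rewrite lee_fin].
rewrite (fsbigE (index_enum I))//; last by move=> i _; rewrite mem_index_enum.
  by rewrite -sumEFin big_mkcond; apply: eq_bigr => i _; rewrite in_setT.
exact: index_enum_uniq.
Qed.

(** Here [t] is [Gact (w, t) z] minus a signed permutation of [z], hence at most M + 2 in each
    coordinate. The bound 2 on [z] accommodates a ball of radius at most 1 around a point with
    coordinates at most 1. *)
Lemma Gact_far {R : realType} {d} M N (w : {ffun 'I_d -> bool} * {perm 'I_d})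
    (t : 'rV[int]_d) (z : vec R d) :
  (forall i, `|z 0 i| <= 2) -> (M.+2 <= N)%N ->
  (forall i, `|Gact (w, t) z 0 i| <= M%:R) -> exists u, cubept N u = t.
Proof.
move=> z2 MN zM; apply: cubeptP => i.
suff : `|(t 0 i)%:~R : R| <= N%:R.
  by rewrite -intr_norm -[N%:R]/(N%:Z%:~R) ler_int.
have -> : (t 0 i)%:~R = Gact (w, t) z 0 i - (-1) ^+ w.1 i * z 0 (w.2 i).
  by rewrite !mxE addrAC subrr add0r.
apply: (le_trans (ler_normB _ _)); rewrite normrM normr_sign mul1r.
apply: (le_trans (lerD (zM i) (z2 _))).
by rewrite -natrD ler_nat addn2.
Qed.

Lemma esum_Gact {R : realType} {d} (P : set (vec R d)) M N (z : vec R d) :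
  (forall x : vec R d, P x -> forall i, `|x 0 i| <= M%:R) ->
  (forall i, `|z 0 i| <= 2) -> (M.+2 <= N)%N ->
  \esum_(g in [set: Gelt d]) ((\1_P (Gact g z) : R)%:E) = (\sum_p \1_P (Gact (gpt N p) z))%:E.
Proof.
move=> PM z2 MN.
rewrite (esum_range (@gpt d N) (fun g => \1_P (Gact g z) : R))//; first exact: gpt_inj.
move=> [w t] nr; rewrite indicE memNset// => /PM Pz; apply: nr.
by have [u ut] := Gact_far M N w t z z2 MN Pz; exists (w, u) => //; rewrite /gpt ut.
Qed.

(** The reciprocal of 1 plus the sum of the inverses replaces a minimum, and also covers an empty
    index type. *)
Lemma exists_lt_all {R : realType} (I : finType) (f : I -> R) : (forall i, 0 < f i) ->
  exists r : R, [/\ 0 < r, r <= 1 & forall i, r < f i].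
Proof.
move=> f0; have s0 : 0 <= \sum_i (f i)^-1 by apply: sumr_ge0 => i _; rewrite invr_ge0 ltW.
have s1 : 0 < 1 + \sum_i (f i)^-1 by rewrite ltr_pwDl.
exists (1 + \sum_i (f i)^-1)^-1; split; first by rewrite invr_gt0.
  by rewrite invf_le1// lerDl.
move=> i; rewrite invf_plt ?posrE// (bigD1 i)//= addrCA ltrDl ltr_pwDl//.
by apply: sumr_ge0 => j _; rewrite invr_ge0 ltW.
Qed.

(** The image of the unit cube under [Gact (s, sigma, t)]; it is the same for every [sigma], as the
    cube is invariant under permutations. *)
Definition signed_cell {R : realType} {d} (s : {ffun 'I_d -> bool}) (t : 'rV[int]_d) :
    set (vec R d) :=
  [set z | forall i, 0 <= (-1) ^+ s i * (z 0 i - (t 0 i)%:~R) < 1].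

Lemma caratheodory_unit_cube {R : realType} {d} : (lmeas R d).-caratheodory (unit_cube R d.+1).
Proof.
pose T := caratheodory_type (lmeas R d).
have -> : unit_cube R d.+1 = \bigcap_(i in [set: 'I_d.+1])
    ((~` [set x : vec R d.+1 | x 0 i < 0]) `&` [set x : vec R d.+1 | x 0 i < 1]).
  apply/seteqP; split=> x /= h i.
    by move=> _; have /andP[ai ?] := h i; split=> //; apply/negP; rewrite -leNgt.
  by have [/negP] := h i Logic.I; rewrite -leNgt => -> /= ->.
apply: (@fin_bigcap_measurable _ T) => // i _; apply: (@measurableI _ T).
  by apply: (@measurableC _ T); apply: (@caratheodory_halfspace _ _ i 0) => x // /ltW.
by apply: (@caratheodory_halfspace _ _ i 1) => x // /ltW.
Qed.

Lemma signed_cell_Gact {R : realType} {d} (g : Gelt d) :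
  Gact g @^-1` (signed_cell g.1.1 g.2) = unit_cube R d.
Proof.
have E i (y : vec R d) : (-1) ^+ g.1.1 i * (Gact g y 0 i - (g.2 0 i)%:~R) = y 0 (g.1.2 i).
  by rewrite !mxE addrK mulrA -expr2 sqrr_sign mul1r.
apply/seteqP; split=> y /= h i; last by rewrite E.
by have := h (g.1.2^-1%g i); rewrite E permKV.
Qed.

Lemma caratheodory_signed_cell {R : realType} {d} s t :
  (lmeas R d).-caratheodory (signed_cell s t).
Proof.
have -> : signed_cell s t = Gact (s, 1%g, \row_i (- ((-1) ^+ s i * t 0 i))) @^-1` unit_cube R d.+1.
  apply/funext => z; rewrite /signed_cell/unit_cube/=; apply: eq_forall => i.
  by rewrite !mxE perm1 mulrBr rmorphN rmorphM rmorphXn rmorphN1.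
by apply: caratheodory_Gact; exact: caratheodory_unit_cube.
Qed.

Lemma signed_cell_sum {R : realType} {d} (s : {ffun 'I_d -> bool}) M N (z : vec R d) :
  (forall i, `|z 0 i| <= M%:R) -> (M.+2 <= N)%N ->
  \sum_(u : {ffun 'I_d -> 'I_(N.*2.+1)}) \1_(signed_cell s (cubept N u)) z = 1 :> R.
Proof.
move=> zM MN.
(* In each coordinate the cell condition says that the signed [t] is the floor of the signed [z], so
   [t0] is the only solution. *)
pose t0 : 'rV[int]_d := \row_i ((-1) ^+ s i * Num.floor ((-1) ^+ s i * z 0 i)).
have cellE t : signed_cell s t z <-> t = t0.
  have E i : (0 <= (-1) ^+ s i * (z 0 i - (t 0 i)%:~R) < 1) = (t 0 i == t0 0 i).
    have -> : (-1) ^+ s i * (z 0 i - (t 0 i)%:~R) = (-1) ^+ s i * z 0 i - ((-1) ^+ s i * t 0 i)%:~R.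
      by rewrite mulrBr rmorphM rmorphXn rmorphN1.
    rewrite subr_ge0 ltrBlDl -intrD1 -floor_eq mxE.
    by case: (s i); rewrite ?expr1 ?expr0 ?mul1r 1?eq_sym// !mulN1r -eqr_oppLR.
  split=> [h|tt0 i]; last by rewrite E tt0.
  by apply/rowP => i; apply/eqP; rewrite -E; exact: h.
have [u0 u0E] : exists u0, cubept N u0 = t0.
  apply: cubeptP => i; rewrite mxE normrM normr_sign mul1r.
  have := floor_itv ((-1) ^+ s i * z 0 i); set f := Num.floor _ => /andP[f1 f2].
  have : `|(-1) ^+ s i * z 0 i| <= M%:R by rewrite normrM normr_sign mul1r.
  rewrite ler_norml => /andP[z1 z2].
  have fM : f <= M%:Z by rewrite -(ler_int R); exact: le_trans z2.
  have Mf : - (M%:Z) < f + 1 by rewrite -(ltr_int R) rmorphN; exact: le_lt_trans f2.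
  by move: fM Mf MN; clear; lia.
rewrite (bigD1 u0)//= big1 ?addr0; first by rewrite indicE mem_set//; apply/cellE.
move=> u uu0; rewrite indicE memNset// => /cellE; rewrite -u0E => /cubept_inj /eqP.
by rewrite (negbTE uu0).
Qed.

Section tiling.
Variables (R : realType) (d : nat) (P : set (vec R d.+1)) (M N : nat) (m : int).
Hypothesis PM : forall x : vec R d.+1, P x -> forall i, `|x 0 i| <= M%:R.
Hypothesis MN : (M.+2 <= N)%N.
Hypothesis mP : (lmeas R d).-caratheodory P.
Hypothesis tileP : ae (fun x : vec R d.+1 =>
  \esum_(g in [set: Gelt d.+1]) ((\1_P (Gact g x) : R)%:E) = (m%:~R)%:E).

Lemma tiling_double_counting (B : set (vec R d.+1)) : (lmeas R d).-caratheodory B ->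
  (forall x : vec R d.+1, B x -> forall i, `|x 0 i| <= 2) ->
  (\sum_p lebesgue_outer (B `&` Gact (gpt N p) @^-1` P) = (m%:~R)%:E * lebesgue_outer B)%E.
Proof.
move=> mB B2; have [Z [Z0 Zm]] := tileP.
apply: (double_counting _ _ Z) => // [p|x /B2 x2 /Zm].
  exact: caratheodory_Gact.
by rewrite (esum_Gact P M N x PM x2 MN) => -[].
Qed.

(** Only finitely many motions matter near [y], so one radius [r] is admissible for all of them.
    Integrating the almost-everywhere identity over that ball and dividing by its volume gives the
    identity at [y] itself. *)
Lemma solid_angle_sum (y : vec R d.+1) :
  (forall x, exists2 r0 : R, 0 < r0 & locally_conic P x r0) ->
  (forall i, `|y 0 i| <= 1) ->
  \sum_p solid_angle P (Gact (gpt N p) y) = m%:~R.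
Proof.
move=> conicP y1.
have /choice[f fP] : forall p, exists r0 : R, 0 < r0 /\ locally_conic P (Gact (gpt N p) y) r0.
  by move=> p; have [r0 ? ?] := conicP (Gact (gpt N p) y); exists r0.
have [r [r0 r1 rf]] := exists_lt_all _ f (fun p => (fP p).1).
have := tiling_double_counting (eball y r) (caratheodory_open _ (open_eball _ _)).
have finB : forall A, A `<=` eball y r -> lebesgue_outer A \is a fin_num.
  by move=> A; apply: lebesgue_outer_eball_fin; exact: ltW.
have fin2 x : eball y r x -> forall i, `|x 0 i| <= 2.
  move=> /(sqnorm_coord _ _ (ltW r0)) xr i; rewrite -(subrK (y 0 i) (x 0 i)).
  apply: (le_trans (ler_normD _ _)); rewrite (_ : 2 = 1 + 1 :> R)//; apply: lerD => //.
  by have := xr i; rewrite !mxE => /ltW /le_trans; apply.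
move=> /(_ fin2).
have volE A : A `<=` eball y r -> lebesgue_outer A = (vol A)%:E.
  by move=> Ay; rewrite /vol fineK// finB.
rewrite (eq_bigr (fun p => (vol (eball y r `&` Gact (gpt N p) @^-1` P))%:E)); last first.
  by move=> p _; rewrite volE// => x [].
rewrite sumEFin volE// -EFinM => -[sumE].
have v0 := vol_eball_gt0 y r r0.
rewrite (eq_bigr (fun p => vol (eball y r `&` Gact (gpt N p) @^-1` P) / vol (eball y r))).
  by rewrite -mulr_suml sumE mulfK// gt_eqF.
by move=> p _; apply: (solid_angle_Gact _ _ _ (f p)); rewrite ?r0 ?rf//; case: (fP p).
Qed.

(* The images of the unit cube under [Gact (w, t)], for fixed [w], tile the space. *)
Lemma tiling_multiplicity :
  m%:~R = #|{: {ffun 'I_d.+1 -> bool} * {perm 'I_d.+1}}|%:R * vol P.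
Proof.
have := tiling_double_counting _ caratheodory_unit_cube.
rewrite lebesgue_outer_unit_cube mule1 => /(_ _).
have cube2 : forall x : vec R d.+1, unit_cube R d.+1 x -> forall i, `|x 0 i| <= 2.
  move=> x x01 i; have /andP[x0 /ltW x1] := x01 i.
  by rewrite ger0_norm//; apply: (le_trans x1); rewrite ler1n.
move=> /(_ cube2).
(* Transport by the motion: the part of the cube sent into [P] has the volume of the part of [P]
   inside the image cell. *)
rewrite (eq_bigr (fun p => lebesgue_outer (P `&` signed_cell p.1.1 (cubept N p.2)))); last first.
  move=> p _; rewrite -(lebesgue_outer_Gact (gpt N p) (P `&` _)) preimage_setI setIC.
  by rewrite (signed_cell_Gact (gpt N p)).
rewrite -(pair_bigA _ (fun w u => lebesgue_outer (P `&` signed_cell w.1 (cubept N u))))/=.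
rewrite (eq_bigr (fun=> lebesgue_outer P)); last first.
  (* Double counting with the roles exchanged: for fixed [w] the cells cut [P] into pieces, with
     multiplicity 1 and no exceptional set. *)
  move=> w _; rewrite (double_counting _ P set0 _ 1) ?mul1e//.
  - by move=> u; exact: caratheodory_signed_cell.
  - by move=> z /PM zM _; exact: signed_cell_sum MN.
have volE : lebesgue_outer P = (vol P)%:E.
  by rewrite /vol fineK//; exact: lebesgue_outer_fin PM.
by rewrite volE sumEFin => -[<-]; rewrite sumr_const mulr_natl.
Qed.

End tiling.

(** * Gauss sums *)

Local Open Scope complex_scope.

Lemma expiD {R : realType} (a b : R) : expi (a + b) = expi a * expi b.
Proof. by rewrite /expi mulrDr cosD sinD/=; simpc; rewrite (addrC (sin _ * cos _)). Qed.

Lemma expi0 {R : realType} : expi (0 : R) = 1.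
Proof. by rewrite /expi mulr0 cos0 sin0. Qed.

Lemma expi_int {R : realType} (z : int) : expi (z%:~R : R) = 1.
Proof.
have nat1 (k : nat) : expi (k%:R : R) = 1.
  elim: k => [|k IH]; first exact: expi0.
  rewrite -natr1 expiD IH mul1r /expi mulr1 (_ : 2 * pi = pi *+ 2) ?mulr_natl//.
  by rewrite cos2pi sin2pi.
case: (intP z) => [|k|k]; [exact: expi0|exact: nat1|].
have := expi0 (R := R); rewrite -(subrr (k.+1%:R)) expiD nat1 mul1r.
by rewrite rmorphN.
Qed.

Lemma expi_sum {R : realType} (I : finType) (a : I -> R) :
  expi (\sum_i a i) = \prod_i expi (a i).
Proof. by apply: (big_morph _ expiD); exact: expi0. Qed.

Lemma gauss_expn {R : realType} (d n : nat) :
  gauss R n ^+ d = \sum_(k : {ffun 'I_d -> 'I_n}) expi (sqnorm (zvec R (\row_i (k i)%:Z)) / n%:R).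
Proof.
rewrite -[in LHS](card_ord d) -prodr_const /gauss bigA_distr_bigA/=.
apply: eq_bigr => k _; rewrite -expi_sum; congr expi; rewrite /sqnorm mulr_suml.
by apply: eq_bigr => i _; rewrite !mxE natrX.
Qed.

(** The partial sums are constant once the cube contains the support, which determines the eventual
    value chosen by [xget]. *)
Lemma lattice_sumE {R : realType} {d} (F : 'rV[int]_d -> R[i]) (N0 : nat) :
  (forall x, F x != 0 -> forall i, `|x 0 i| <= N0%:Z) ->
  lattice_sum F = \sum_(x \in [set: 'rV[int]_d]) F x.
Proof.
move=> F0; have sumE N : (N0 <= N)%N -> cube_sum F N = \sum_(x \in [set: 'rV[int]_d]) F x.
  move=> N0N; rewrite (fsbig_range (@cubept d N))//; first exact: cubept_inj.
  move=> x nx; apply/eqP; apply: contrapT => /negP/F0 xN0; apply: nx.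
  have [i|u ux] := cubeptP N x; last by exists u.
  by apply: (le_trans (xN0 i)); rewrite lez_nat.
apply: xget_subset1; first by exists N0 => N /sumE.
by move=> S S' [N1 h1] [N2 h2]; rewrite -(h1 (maxn N1 N2)) ?leq_maxl// h2// leq_maxr.
Qed.

(* Every lattice point is uniquely [w k + n t] with [k] reduced modulo [n]. *)
Definition residue_pt {d} n N (w : {ffun 'I_d -> bool} * {perm 'I_d})
    (p : {ffun 'I_d -> 'I_n} * {ffun 'I_d -> 'I_(N.*2.+1)}) : 'rV[int]_d :=
  \row_i ((-1) ^+ w.1 i * (p.1 (w.2 i))%:Z + n%:Z * cubept N p.2 0 i).

Lemma residue_pt_inj {d} n N w : injective (@residue_pt d n N w).
Proof.
move=> [k u] [k' u'] /rowP /= E.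
have {}E i : k (w.2 i) = k' (w.2 i) /\ cubept N u 0 i = cubept N u' 0 i.
  have := E i; rewrite [LHS]mxE [RHS]mxE/=; move: (cubept _ _ _ _) (cubept _ _ _ _) => a b.
  have ltk := ltn_ord (k (w.2 i)); have ltk' := ltn_ord (k' (w.2 i)).
  case: (ltgtP a b) => ab H.
  (* Different quotients move the point by at least [n], whereas two remainders differ by less than
     [n], whatever their common sign. *)
  - suff : n%:Z * (a + 1) <= n%:Z * b by case: (w.1 i) H; rewrite ?expr1 ?expr0; lia.
    by apply: ler_wpM2l => //; lia.
  - suff : n%:Z * (b + 1) <= n%:Z * a by case: (w.1 i) H; rewrite ?expr1 ?expr0; lia.
    by apply: ler_wpM2l => //; lia.
  - by split=> //; apply: val_inj => /=; case: (w.1 i) H; rewrite ?expr1 ?expr0 ab; lia.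
congr pair; last by apply: cubept_inj; apply/rowP => i; case: (E i).
by apply/ffunP => j; rewrite -(permKV w.2 j); case: (E (w.2^-1%g j)).
Qed.

Lemma residue_exists {d} n (w : {ffun 'I_d -> bool} * {perm 'I_d}) (x : 'rV[int]_d) :
  (0 < n)%N -> exists (k : {ffun 'I_d -> 'I_n}) (t : 'rV[int]_d),
    x = \row_i ((-1) ^+ w.1 i * (k (w.2 i))%:Z + n%:Z * t 0 i).
Proof.
(* Euclidean division is applied to the signed coordinate, so that the remainder is nonnegative
   before the sign is restored. *)
case: n => // n _; pose sx i : int := (-1) ^+ w.1 i * x 0 i.
exists [ffun j => inord `|(sx (w.2^-1%g j) %% n.+1%:Z)%Z|%N].
exists (\row_i ((-1) ^+ w.1 i * (sx i %/ n.+1%:Z)%Z)).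
apply/rowP => i; rewrite !mxE ffunE permK.
have r0 : (0 <= sx i %% n.+1%:Z)%Z by exact: modz_ge0.
have rn : (sx i %% n.+1%:Z < n.+1%:Z)%Z by exact: ltz_pmod.
rewrite inordK; last by move: r0 rn; clear; lia.
rewrite gez0_abs// mulrCA -mulrDr (mulrC n.+1%:Z) addrC -divz_eq /sx.
by rewrite mulrA -expr2 sqrr_sign mul1r.
Qed.

Lemma expi_residue {R : realType} {d} n N w
    (p : {ffun 'I_d -> 'I_n} * {ffun 'I_d -> 'I_(N.*2.+1)}) :
  (0 < n)%N ->
  expi (sqnorm (zvec R (residue_pt n N w p)) / n%:R) =
  expi (sqnorm (zvec R (\row_i (p.1 i)%:Z)) / n%:R).
Proof.
move=> n0; have n0' : n%:R != 0 :> R by rewrite pnatr_eq0 -lt0n.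
(* With sign s, remainder k and quotient u, (s k + n u)^2 / n = k^2 / n + u (2 s k + n u); [q i] is
   this last, integral term. *)
pose q i : int := cubept N p.2 0 i *
  (2 * (-1) ^+ w.1 i * (p.1 (w.2 i))%:Z + n%:Z * cubept N p.2 0 i).
rewrite -[RHS]mulr1 -(expi_int (\sum_i q i)) -expiD; congr expi.
rewrite /sqnorm [in RHS](reindex_inj (@perm_inj _ w.2)) rmorph_sum/= !mulr_suml -big_split/=.
apply: eq_bigr => i _; rewrite !mxE /q mxE.
rewrite !(rmorphM, rmorphD, rmorphXn, rmorphN1)/=.
case: (w.1 i); rewrite ?expr1 ?expr0 ?mul1r ?mulN1r; field; exact: n0'.
Qed.

(** Beyond [M + 1] in some coordinate, a ball of radius below 1 misses [P]. *)
Lemma solid_angle_support {R : realType} {d} (P : set (vec R d.+1)) M x r0 :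
  (forall x : vec R d.+1, P x -> forall i, `|x 0 i| <= M%:R) ->
  0 < r0 -> locally_conic P x r0 -> solid_angle P x != 0 -> forall i, `|x 0 i| <= M.+1%:R.
Proof.
move=> PM r00 cP + i; apply: contraNT; rewrite -ltNge => xM.
pose r := Num.min r0 1 / 2.
have m0 : 0 < Num.min r0 1 by rewrite lt_min r00 ltr01.
have r_gt0 : 0 < r by rewrite divr_gt0.
have hm : r < Num.min r0 1 by rewrite ltr_pdivrMr// ltr_pMr// ltr1n.
move: hm; rewrite lt_min => /andP[rr0 r1].
rewrite (solid_angleE _ _ _ r cP) ?r_gt0//.
suff -> : eball x r `&` P = set0 by rewrite /vol lebesgue_outer0 mul0r.
apply/seteqP; split=> // y [/(sqnorm_coord _ _ (ltW r_gt0)) /(_ i) yx /PM /(_ i) yM].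
move: xM; rewrite ltNge => /negP; apply.
rewrite -(subKr (y 0 i) (x 0 i)); apply: (le_trans (ler_normB _ _)).
rewrite -natr1; apply: lerD => //; move: yx; rewrite !mxE => /ltW /le_trans; apply.
exact: ltW.
Qed.

Lemma poly_gauss_tiling {R : realType} {d} (P : set (vec R d.+1)) (M : nat) (m : int) (n : nat) :
  (0 < n)%N ->
  (forall x : vec R d.+1, P x -> forall i, `|x 0 i| <= M%:R) ->
  (lmeas R d).-caratheodory P ->
  (forall x, exists2 r0 : R, 0 < r0 & locally_conic P x r0) ->
  ae (fun x : vec R d.+1 =>
    \esum_(g in [set: Gelt d.+1]) ((\1_P (Gact g x) : R)%:E) = (m%:~R)%:E) ->
  poly_gauss P n = (vol P)%:C * gauss R n ^+ d.+1.
Proof.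
(* Solid angles vanish beyond [M + 1], and [Gact_far] asks for 2 more. *)
move=> n0 PM mP conicP tileP; pose N := M.+3.
pose W := {: {ffun 'I_d.+1 -> bool} * {perm 'I_d.+1}}.
have n0' : 0 < n%:R :> R by rewrite ltr0n.
have n00 : n%:R != 0 :> R by rewrite gt_eqF.
pose om (x : 'rV[int]_d.+1) : R := solid_angle P (n%:R^-1 *: zvec R x).
pose f (x : 'rV[int]_d.+1) : R[i] := expi (sqnorm (zvec R x) / n%:R).
have FE x : (solid_angle (dilate n%:R P) (zvec R x))%:C * expi (sqnorm (zvec R x) / n%:R)
    = (om x)%:C * f x.
  have [r0 r00 cP] := conicP (n%:R^-1 *: zvec R x).
  have xE : zvec R x = n%:R *: (n%:R^-1 *: zvec R x) by rewrite scalerA divff// scale1r.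
  congr (_%:C * _); rewrite {1}xE; exact: solid_angle_dilate n0' r00 cP.
have om_supp x : om x != 0 -> forall i, `|n%:R^-1 * (x 0 i)%:~R| <= M.+1%:R :> R.
  have [r0 r00 cP] := conicP (n%:R^-1 *: zvec R x).
  by move=> /(solid_angle_support _ _ _ _ PM r00 cP) h i; have := h i; rewrite !mxE.
have F_supp x : (om x)%:C * f x != 0 -> om x != 0.
  by apply: contraNN => /eqP ->; rewrite mul0r.
have om_res (w : W) (p : {ffun 'I_d.+1 -> 'I_n} * {ffun 'I_d.+1 -> 'I_(N.*2.+1)}) :
    om (residue_pt n N w p) =
    solid_angle P (Gact (gpt N (w, p.2)) (n%:R^-1 *: zvec R (\row_i (p.1 i)%:Z))).
  rewrite /om; congr solid_angle; apply/rowP => i; rewrite !mxE.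
  rewrite !(rmorphM, rmorphD, rmorphXn, rmorphN1)/= mulrDr mulrA mulrA mulVf// mul1r mulrCA.
  by rewrite -mulrA.
have small (k : {ffun 'I_d.+1 -> 'I_n}) i :
    `|(n%:R^-1 *: zvec R (\row_i (k i)%:Z)) 0 i| <= 1.
  by rewrite !mxE ger0_norm ?mulr_ge0 ?invr_ge0// mulrC ler_pdivrMr// mul1r ler_nat ltnW.
have sumW (w : W) : \sum_(x \in [set: 'rV[int]_d.+1]) (om x)%:C * f x =
    \sum_k \sum_u (om (residue_pt n N w (k, u)))%:C * f (\row_i (k i)%:Z).
  rewrite (fsbig_range (residue_pt n N w)); first last.
  - move=> x nx; apply/eqP; apply: contrapT => /negP /F_supp /om_supp xM; apply: nx.
    have [k [t xE]] := residue_exists n w x n0.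
    have [||i|u ut] := Gact_far M.+1 N w t (n%:R^-1 *: zvec R (\row_i (k i)%:Z)) => //.
    - by move=> i; apply: (le_trans (small k i)); rewrite ler1n.
    - have := xM i; rewrite {1}xE; congr (`|_| <= _).
      rewrite !mxE !(rmorphM, rmorphD, rmorphXn, rmorphN1)/=.
      by move: ((-1) ^+ _) => e; field.
    by exists (k, u) => //; rewrite xE; apply/rowP => i; rewrite !mxE -ut mxE.
  - exact: residue_pt_inj.
  rewrite pair_bigA/=; apply: eq_bigr => -[k u] _.
  by rewrite /f expi_residue.
have -> : poly_gauss P n = \sum_(x \in [set: 'rV[int]_d.+1]) (om x)%:C * f x.
  rewrite /poly_gauss (lattice_sumE _ (n * M.+1)); last first.
    move=> x; rewrite FE => /F_supp /om_supp xM i.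
    have := xM i; rewrite normrM normfV normr_nat mulrC ler_pdivrMr// -intr_norm -natrM mulnC.
    by rewrite -[(n * _)%:R]/((n * M.+1)%N%:Z%:~R) ler_int.
  by apply: eq_fsbigr => x _; exact: FE.
have W0 : #|W|%:R != 0 :> R[i].
  by rewrite pnatr_eq0 -lt0n; apply/card_gt0P; exists ([ffun=> false], 1%g).
(* Multiplying by the order of W gives one copy of the sum for each [w], each expanded by [sumW]
   along its own residues. After the exchange, the weight depends on [k] alone and factors out of
   the sum over motions. *)
apply: (mulfI W0); rewrite mulr_natl -[LHS]sumr_const.
rewrite (eq_bigr _ (fun w _ => sumW w)) exchange_big/= gauss_expn mulrA.
have -> : #|W|%:R * (vol P)%:C = (m%:~R : R)%:C.
  by rewrite (tiling_multiplicity _ _ P M N m)// rmorphM rmorph_nat.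
rewrite mulr_sumr; apply: eq_bigr => k _; rewrite pair_bigA/= -mulr_suml; congr (_ * _).
rewrite -rmorph_sum; congr (_%:C).
rewrite -(solid_angle_sum R d P M N m PM (leqnSn _) mP tileP _ conicP (small k)).
by apply: eq_bigr => -[w u] _; rewrite om_res.
Qed.

Theorem theorem1 (R : realType) (d : nat) (V : seq 'rV[int]_d) :
  (1 <= d)%N -> V <> [::] ->
  multitiles (lattice_hull (R:=R) V) ->
  forall n : nat, (0 < n)%N ->
    poly_gauss (lattice_hull (R:=R) V) n
    = ((vol (lattice_hull (R:=R) V))%:C * gauss R n ^+ d)%C.
Proof.
case: d V => // d V _ _ [m tile] n n0.
have [M PM] := lattice_hull_bounded R d.+1 V.
apply: (poly_gauss_tiling _ M m) => //; last exact: lattice_hull_conic.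
by apply: caratheodory_closed; exact: closed_lattice_hull.
Qed.
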